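(* Let $A$ and $B$ be associative superalgebras over a field $\mathbb{K}$ of characteristic zero, let $B$ be an associative $A$-bimodule, and let $H:A\to B$ be a crossed homomorphism. Let $H_t=\sum_{i=0}^{n}t^iH_i$ be a formal one-parameter deformation of $H$ of order $n$. For $1\le m\le n$ let $$ob_H^m=-\frac12\sum_{\substack{i+j=m\\ i,j\ge1}}[\![H_i,H_j]\!]_1\in \mathrm{Hom}(A^{\otimes 2},B)$$ be the obstruction of order $m$. Then the obstructions are cocycles, that is, $d_H(ob_H^m)=0$ (for every $1\le m\le n$).
   Context: An associative superalgebra is a $\mathbb{Z}_2$-graded vector space $A=A_0\oplus A_1$ with a bilinear associative product satisfying $A_iA_j\subseteq A_{i+j}$ (no unit is assumed). $|a|$ denotes the $\mathbb{Z}_2$-degree of a homogeneous element $a$. An even (degree $0$) linear map is one preserving the $\mathbb{Z}_2$-grading. For associative superalgebras $A,B$, ''$B$ is an associative $A$-bimodule'' means that there are degree $0$ bilinear maps $A\otimes B\to B$, $(a,x)\mapsto a\cdot x$, and $B\otimes A\to B$, $(x,a)\mapsto x\cdot a$, such that for all homogeneous $a,b\in A$, $x,y\in B$: $(ab)\cdot x=a\cdot(b\cdot x)$, $(a\cdot x)\cdot b=a\cdot(x\cdot b)$, $(x\cdot a)\cdot b=x\cdot(ab)$, $(a\cdot x)y=a\cdot(xy)$, $(x\cdot a)y=x(a\cdot y)$, $(xy)\cdot a=x(y\cdot a)$. A crossed homomorphism $H:A\to B$ is a linear map of degree $0$ with $H(ab)=a\cdot H(b)+H(a)\cdot b+H(a)H(b)$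 for all homogeneous $a,b\in A$. Cochains: $C^k(A,B)=\mathrm{Hom}(A^{\otimes k},B)$ for $k\ge 0$. A homogeneous $f\in C^p(A,B)$ has bidegree $(p,\alpha_f)$, where $|f(a_1,\dots,a_p)|=\alpha_f+|a_1|+\cdots+|a_p|$ modulo $2$ for homogeneous $a_i$. For homogeneous $f\in C^p(A,B)$, $g\in C^q(A,B)$ and homogeneous $a_i\in A$, $$[\![f,g]\!]_1(a_1,\dots,a_{p+q})=(-1)^{\alpha_f\alpha_g+\alpha_f(|a_1|+\cdots+|a_q|)}\,g(a_1,\dots,a_q)\,f(a_{q+1},\dots,a_{p+q})+(-1)^{pq+1+\alpha_g(|a_1|+\cdots+|a_p|)}\,f(a_1,\dots,a_p)\,g(a_{p+1},\dots,a_{p+q}),$$ $$(df)(a_1,\dots,a_{p+1})=(-1)^{p-1+\alpha_f|a_1|}a_1\cdot f(a_2,\dots,a_{p+1})+f(a_1,\dots,a_p)\cdot a_{p+1}-(-1)^{p-1}\sum_{i=1}^{p}(-1)^{i-1}f(a_1,\dots,a_{i-1},a_ia_{i+1},a_{i+2},\dots,a_{p+1}),$$ and $d_H=d+[\![H,-]\!]_1$. A $k$-cocycle is an $f\in C^k(A,B)$ with $d_Hf=0$. A formal one-parameter deformation of $H$ of order $n$ is a linear map $H_t: A[[t]]/(t^{n+1})\to B[[t]]/(t^{n+1})$ of the form $H_t=\sum_{i=0}^{n}t^iH_i$ (extended $t$-linearly), with $H_0=H$ and $H_i:A\to B$ an even linear map for $1\le i\le n$, such that $H_t(xy)=H_t(x)\cdot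 y+x\cdot H_t(y)+H_t(x)H_t(y)$ modulo $t^{n+1}$ for all homogeneous $x,y\in A$. For such a deformation one has $ob_H^m=d_H(H_m)$ for all $1\le m\le n$; the paper defines $ob_H^m$ as the left-hand side of this equation. *)

(* Defs.v *)
From HB Require Import structures.
From mathcomp Require Import all_boot all_order all_algebra.

Set Implicit Arguments.
Unset Strict Implicit.
Unset Printing Implicit Defensive.

Import GRing.Theory.
Local Open Scope ring_scope.

(* Z_2 is encoded as bool: [false] is the even degree, [true] the odd degree, *)
(* [addb] is the addition and a degree is read as 0 or 1 in the exponents of  *)
(* the Koszul signs through the coercion from bool to nat.                    *)

HB.mixin Record isSuperspace (K : fieldType) V of GRing.Lmodule K V := {
  grade : bool -> {pred V};
  grade_submod_closed : forall i, submod_closed (grade i);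
  grade_cover : forall v : V,
    exists2 v0 : V, v0 \in grade false & v - v0 \in grade true;
  grade_cap : forall v : V, v \in grade false -> v \in grade true -> v = 0
}.

#[short(type="superspaceType")]
HB.structure Definition Superspace (K : fieldType) :=
  { V of isSuperspace K V & GRing.Lmodule K V }.

(* No unit is assumed, so the product cannot be that of a MathComp ring. *)
HB.mixin Record isSuperAlgebra (K : fieldType) A of Superspace K A := {
  smul : {bilinear A -> A -> A};
  smulA : forall x y z : A, smul x (smul y z) = smul (smul x y) z;
  smul_grade : forall (i j : bool) (x y : A),
    x \in grade i -> y \in grade j -> smul x y \in grade (i (+) j)
}.

#[short(type="superAlgType")]
HB.structure Definition SuperAlgebra (K : fieldType) :=
  { A of isSuperAlgebra K A & Superspace K A }.

Section Components.
Variables (K : fieldType) (V : superspaceType K).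

Definition homogeneous (v : V) : Prop := exists i, v \in grade i.

Fact even_part_subproof (v : V) :
  exists v0 : V, (v0 \in grade false) && (v - v0 \in grade true).
Proof. by have [v0 h0 h1] := grade_cover v; exists v0; apply/andP. Qed.

(* The homogeneous component of degree i of v. *)
Definition part (i : bool) (v : V) : V :=
  let v0 := xchoose (even_part_subproof v) in if i then v - v0 else v0.

Lemma part_grade i v : part i v \in grade i.
Proof.
by have /andP[] := xchooseP (even_part_subproof v); rewrite /part; case: i.
Qed.

Lemma part_sum v : v = part false v + part true v.
Proof. by rewrite /part addrC subrK. Qed.

Lemma gradeD i (u v : V) : u \in grade i -> v \in grade i -> u + v \in grade i.
Proof.
by move=> ui vi; have [_ /(_ 1 u v ui vi)] := @grade_submod_closed K V i;
  rewrite scale1r.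
Qed.

Lemma gradeZ i c (v : V) : v \in grade i -> c *: v \in grade i.
Proof.
move=> vi; have [z /(_ c v 0 vi z)] := @grade_submod_closed K V i.
by rewrite addr0.
Qed.

Lemma partE v v0 v1 : v0 \in grade false -> v1 \in grade true ->
  v = v0 + v1 -> forall i, part i v = if i then v1 else v0.
Proof.
move=> h0 h1 hv.
have e0 : part false v - v0 = 0.
  apply: grade_cap; first by rewrite -scaleN1r gradeD ?gradeZ ?part_grade.
  have -> : part false v - v0 = v1 - part true v.
    apply/eqP; rewrite subr_eq addrAC eq_sym subr_eq -part_sum hv.
    by rewrite addrC.
  by rewrite -scaleN1r gradeD ?gradeZ ?part_grade.
have {}e0 : part false v = v0 by apply/eqP; rewrite -subr_eq0 e0.
case=> //; apply: (addrI v0).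
by rewrite -{1}e0 -part_sum.
Qed.

Lemma part_homog i j v : v \in grade i -> part j v = if i == j then v else 0.
Proof.
have z k : (0 : V) \in grade k by have [] := @grade_submod_closed K V k.
by case: i => vi; [rewrite (@partE v 0 v) ?add0r | rewrite (@partE v v 0) ?addr0];
  case: j.
Qed.

End Components.

Definition even_map (K : fieldType) (V W : superspaceType K) (f : V -> W) :=
  forall (i : bool) (v : V), v \in grade i -> f v \in grade i.

Record bimodule (K : fieldType) (A B : superAlgType K) := Bimodule {
  lact : {bilinear A -> B -> B};
  ract : {bilinear B -> A -> B};
  lact_grade : forall (i j : bool) (a : A) (x : B),
    a \in grade i -> x \in grade j -> lact a x \in grade (i (+) j);
  ract_grade : forall (i j : bool) (x : B) (a : A),
    x \in grade i -> a \in grade j -> ract x a \in grade (i (+) j);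
  bimod_mulll : forall (a b : A) (x : B),
    homogeneous a -> homogeneous b -> homogeneous x ->
    lact (smul a b) x = lact a (lact b x);
  bimod_lr : forall (a b : A) (x : B),
    homogeneous a -> homogeneous b -> homogeneous x ->
    ract (lact a x) b = lact a (ract x b);
  bimod_mulrr : forall (a b : A) (x : B),
    homogeneous a -> homogeneous b -> homogeneous x ->
    ract (ract x a) b = ract x (smul a b);
  bimod_lmul : forall (a : A) (x y : B),
    homogeneous a -> homogeneous x -> homogeneous y ->
    smul (lact a x) y = lact a (smul x y);
  bimod_mid : forall (a : A) (x y : B),
    homogeneous a -> homogeneous x -> homogeneous y ->
    smul (ract x a) y = smul x (lact a y);
  bimod_rmul : forall (a : A) (x y : B),
    homogeneous a -> homogeneous x -> homogeneous y ->
    ract (smul x y) a = smul x (ract y a)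
}.

Section Cohomology.
Variables (K : fieldType) (A B : superAlgType K).

Definition crossed_hom (M : bimodule A B) (H : A -> B) : Prop :=
  even_map H /\
  forall a b : A, homogeneous a -> homogeneous b ->
    H (smul a b) = lact M a (H b) + ract M (H a) b + smul (H a) (H b).

(* Elements of C^k(A, B) are the multilinear functions of k arguments. *)
Definition cochain (k : nat) := {ffun 'I_k -> A} -> B.

Definition subst k (a : {ffun 'I_k -> A}) (i : 'I_k) (x : A) :
  {ffun 'I_k -> A} := [ffun j => if j == i then x else a j].

Definition multilinear k (f : cochain k) : Prop :=
  forall (a : {ffun 'I_k -> A}) (i : 'I_k) (c : K) (x y : A),
    f (subst a i (c *: x + y)) = c *: f (subst a i x) + f (subst a i y).

Definition has_degrees k (e : {ffun 'I_k -> bool}) (a : {ffun 'I_k -> A}) :=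
  forall i, a i \in grade (e i).

Definition total_degree k (e : {ffun 'I_k -> bool}) : bool :=
  \big[addb/false]_i e i.

Definition homog_cochain k (alpha : bool) (f : cochain k) : Prop :=
  forall e a, has_degrees e a -> f a \in grade (alpha (+) total_degree e).

(* A formula [F e a] given for arguments a_i of degree e_i is extended to     *)
(* arbitrary arguments by summing over all their homogeneous components.      *)
Definition components k (e : {ffun 'I_k -> bool}) (a : {ffun 'I_k -> A}) :
  {ffun 'I_k -> A} := [ffun i => part (e i) (a i)].

Definition extend k (F : {ffun 'I_k -> bool} -> cochain k) : cochain k :=
  fun a => \sum_(e : {ffun 'I_k -> bool}) F e (components e a).

(* The component of degree alpha of a (not necessarily homogeneous) cochain. *)
Definition cochain_part k (alpha : bool) (f : cochain k) : cochain k :=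
  extend (fun e a => part (alpha (+) total_degree e) (f a)).

Section Blocks.
Variables (T : Type) (p q : nat) (a : {ffun 'I_(p + q) -> T}).

(* [firstp], [lastq] : the first p and the last q of p + q arguments;         *)
(* [firstq], [lastp] : the first q and the last p of them.                    *)
Definition firstp : {ffun 'I_p -> T} := [ffun i => a (lshift q i)].
Definition lastq : {ffun 'I_q -> T} := [ffun i => a (rshift p i)].
Definition firstq : {ffun 'I_q -> T} :=
  [ffun i => a (cast_ord (addnC q p) (lshift p i))].
Definition lastp : {ffun 'I_p -> T} :=
  [ffun i => a (cast_ord (addnC q p) (rshift q i))].
End Blocks.

Definition bracket_formula p q (alpha beta : bool) (f : cochain p)
    (g : cochain q) (e : {ffun 'I_(p + q) -> bool}) : cochain (p + q) := fun a =>
  (-1) ^+ (alpha * beta + alpha * \sum_(i < q) firstq e i)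
    *: smul (g (firstq a)) (f (lastp a))
  + (-1) ^+ (p * q + 1 + beta * \sum_(i < p) firstp e i)
    *: smul (f (firstp a)) (g (lastq a)).

Definition bracket p q (f : cochain p) (g : cochain q) : cochain (p + q) :=
  fun a => \sum_(alpha : bool) \sum_(beta : bool)
    extend (bracket_formula alpha beta (cochain_part alpha f)
                                       (cochain_part beta g)) a.

(* [behead_args a] = (a_2, ..., a_{p+1}) and [belast_args a] = (a_1, ..., a_p) *)
Definition behead_args T p (a : {ffun 'I_p.+1 -> T}) : {ffun 'I_p -> T} :=
  [ffun j => a (lift ord0 j)].
Definition belast_args T p (a : {ffun 'I_p.+1 -> T}) : {ffun 'I_p -> T} :=
  [ffun j => a (widen_ord (leqnSn p) j)].

(* With i counted from 0: (a_0, ..., a_{i-1}, a_i a_{i+1}, a_{i+2}, ..., a_p) *)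
Definition face p (i : 'I_p) (a : {ffun 'I_p.+1 -> A}) : {ffun 'I_p -> A} :=
  [ffun j : 'I_p =>
    if (j < i)%N then belast_args a j
    else if j == i then smul (belast_args a i) (behead_args a i)
    else behead_args a j].

(* The sign (-1)^(p-1) is written (-1)^(p+1), which also covers p = 0; the    *)
(* index i is counted from 0, so that (-1)^(i-1) becomes (-1)^i.              *)
Definition d_formula (M : bimodule A B) p (alpha : bool) (f : cochain p)
    (e : {ffun 'I_p.+1 -> bool}) : cochain p.+1 := fun a =>
  (-1) ^+ (p + 1 + alpha * e ord0) *: lact M (a ord0) (f (behead_args a))
  + ract M (f (belast_args a)) (a ord_max)
  - (-1) ^+ (p + 1) *: \sum_(i < p) (-1) ^+ i *: f (face i a).

Definition d (M : bimodule A B) p (f : cochain p) : cochain p.+1 :=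
  fun a => \sum_(alpha : bool)
    extend (d_formula M alpha (cochain_part alpha f)) a.

(* For homogeneous cochains and arguments the defining formulas hold verbatim. *)

Definition vanishing k (f : cochain k) : Prop :=
  forall (a : {ffun 'I_k -> A}) (i : 'I_k), a i = 0 -> f a = 0.

Lemma multilinear_vanishing k (f : cochain k) : multilinear f -> vanishing f.
Proof.
move=> fL a i ai0.
have subst_id : subst a i 0 = a.
  by apply/ffunP => j; rewrite ffunE; case: eqP => // ->.
by have := fL a i (-1) 0 0; rewrite scaler0 addr0 subst_id scaleN1r addNr.
Qed.

Lemma extendE k (F : {ffun 'I_k -> bool} -> cochain k) e a :
  has_degrees e a -> (forall e', vanishing (F e')) -> extend F a = F e a.
Proof.
move=> ea F0; rewrite /extend (bigD1 e) //= big1 ?addr0.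
  by congr (F e _); apply/ffunP=> i; rewrite ffunE (part_homog _ (ea i)) eqxx.
move=> e' ne; have [i nei] : exists i, e' i != e i.
  by apply/existsP; apply: contraR ne => /existsPn h; apply/eqP/ffunP=> i;
     apply/eqP; have := h i; rewrite negbK.
by apply: (F0 e' _ i); rewrite ffunE (part_homog _ (ea i)) eq_sym (negPf nei).
Qed.

Lemma vanishing_extend k (F : {ffun 'I_k -> bool} -> cochain k) :
  (forall e, vanishing (F e)) -> vanishing (extend F).
Proof.
move=> F0 a i ai0; rewrite /extend big1 // => e _.
have z : (0 : A) \in grade (e i) by have [] := @grade_submod_closed K A (e i).
by apply: (F0 e _ i); rewrite ffunE ai0 (part_homog _ z) if_same.
Qed.

Lemma vanishing_part k alpha (f : cochain k) (e : {ffun 'I_k -> bool}) :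
  vanishing f -> vanishing (fun a => part (alpha (+) total_degree e) (f a)).
Proof.
move=> f0 a i ai0; rewrite (f0 a i ai0).
have z : (0 : B) \in grade false by have [] := @grade_submod_closed K B false.
by rewrite (part_homog _ z) if_same.
Qed.

Lemma vanishing_cochain_part k alpha (f : cochain k) :
  vanishing f -> vanishing (cochain_part alpha f).
Proof. by move=> f0; apply: vanishing_extend => e; apply: vanishing_part. Qed.

Lemma cochain_partE k alpha beta (f : cochain k) e a :
  vanishing f -> homog_cochain alpha f -> has_degrees e a ->
  cochain_part beta f a = if alpha == beta then f a else 0.
Proof.
move=> f0 hf ea; rewrite /cochain_part (extendE ea) => [|e']; last first.
  exact: vanishing_part.
rewrite (part_homog _ (hf e a ea)).
by case: alpha {hf}; case: beta; case: total_degree.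
Qed.

Lemma bracketE p q alpha beta (f : cochain p) (g : cochain q) e a :
  multilinear f -> multilinear g ->
  homog_cochain alpha f -> homog_cochain beta g -> has_degrees e a ->
  bracket f g a = bracket_formula alpha beta f g e a.
Proof.
move=> /multilinear_vanishing f0 /multilinear_vanishing g0 hf hg ea.
have vF al be e' : vanishing (bracket_formula al be (cochain_part al f)
                                                    (cochain_part be g) e').
  move=> b i bi0; rewrite /bracket_formula.
  have fz := vanishing_cochain_part al f0; have gz := vanishing_cochain_part be g0.
  have -> : smul (cochain_part be g (firstq b)) (cochain_part al f (lastp b)) = 0.
    have [j ji] : exists j, cast_ord (addnC q p) j = i.
      by exists (cast_ord (addnC p q) i); apply: val_inj.
    case: (split_ordP j) => j' ej.
      by rewrite (gz _ j') ?linear0l // ffunE -ej ji.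
    by rewrite (fz _ j') ?linear0r // ffunE -ej ji.
  have -> : smul (cochain_part al f (firstp b)) (cochain_part be g (lastq b)) = 0.
    case: (split_ordP i) => j' ej.
      by rewrite (fz _ j') ?linear0l // ffunE -ej.
    by rewrite (gz _ j') ?linear0r // ffunE -ej.
  by rewrite !scaler0 addr0.
have e1 : has_degrees (firstp e) (firstp a) by move=> i; rewrite !ffunE.
have e2 : has_degrees (lastq e) (lastq a) by move=> i; rewrite !ffunE.
have e3 : has_degrees (firstq e) (firstq a) by move=> i; rewrite !ffunE.
have e4 : has_degrees (lastp e) (lastp a) by move=> i; rewrite !ffunE.
have E al be : extend (bracket_formula al be (cochain_part al f)
     (cochain_part be g)) a =
   if (alpha == al) && (beta == be) then bracket_formula alpha beta f g e a else 0.
  rewrite (extendE ea (vF al be)) /bracket_formula.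
  rewrite (cochain_partE _ f0 hf e1) (cochain_partE _ f0 hf e4).
  rewrite (cochain_partE _ g0 hg e2) (cochain_partE _ g0 hg e3).
  case: (alpha =P al) => [<-|_]; last by rewrite linear0l linear0r !scaler0 addr0.
  by case: (beta =P be) => [<-|_] //; rewrite linear0l linear0r !scaler0 addr0.
rewrite /bracket (bigD1 alpha) //= (bigD1 beta) //= E !eqxx /=.
rewrite big1 ?addr0 => [|j nj]; last by rewrite E eqxx eq_sym (negPf nj).
rewrite big1 ?addr0 // => i ni; rewrite big1 // => j _.
by rewrite E eq_sym (negPf ni).
Qed.

Lemma has_degrees_face p (i : 'I_p) e (a : {ffun 'I_p.+1 -> A}) :
  has_degrees e a ->
  has_degrees [ffun j : 'I_p => if (j < i)%N then belast_args e j
                 else if j == i then belast_args e i (+) behead_args e i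
                 else behead_args e j] (face i a).
Proof.
move=> ea j; rewrite !ffunE; case: ifP => _; first exact: ea.
by case: ifP => _; [exact: smul_grade | exact: ea].
Qed.

Lemma dE (M : bimodule A B) p alpha (f : cochain p) e a :
  multilinear f -> homog_cochain alpha f -> has_degrees e a ->
  d M f a = d_formula M alpha f e a.
Proof.
move=> /multilinear_vanishing f0 hf ea.
have vF al e' : vanishing (d_formula M al (cochain_part al f) e').
  move=> b i bi0; rewrite /d_formula.
  have fz := vanishing_cochain_part al f0.
  have -> : lact M (b ord0) (cochain_part al f (behead_args b)) = 0.
    case: (unliftP ord0 i) => [j|] ej; last by rewrite -ej bi0 linear0l.
    by rewrite (fz _ j) ?linear0r // ffunE -ej.
  have -> : ract M (cochain_part al f (belast_args b)) (b ord_max) = 0.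
    case: (unliftP ord_max i) => [j|] ej; last by rewrite -ej bi0 linear0r.
    rewrite (fz _ j) ?linear0l // ffunE -bi0 ej; congr (b _).
    by apply: val_inj; apply: esym (lift_max j).
  rewrite big1 ?scaler0 ?addr0 ?subr0 // => k _.
  suff -> : cochain_part al f (face k b) = 0 by rewrite scaler0.
  have [lt_ik|le_ki] := ltnP i k.
    have ip : (i < p)%N by exact: ltn_trans (ltn_ord k).
    apply: (fz _ (Ordinal ip)); rewrite !ffunE /= lt_ik -bi0.
    by congr (b _); apply: val_inj.
  have [eik|nik] := eqVneq (i : nat) k.
    apply: (fz _ k); rewrite !ffunE ltnn eqxx.
    have -> : widen_ord (leqnSn p) k = i by apply: val_inj.
    by rewrite bi0 linear0l.
  have lt_ki : (k < i)%N by rewrite ltn_neqAle eq_sym nik.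
  case: (unliftP ord0 i) => [j|] ej; last by move: lt_ki; rewrite ej.
  have kj : (k <= j)%N by move: lt_ki; rewrite ej lift0.
  apply: (fz _ j); rewrite !ffunE ltnNge kj /=.
  by case: eqP => [<-|_]; rewrite -ej bi0 // linear0r.
have e1 : has_degrees (behead_args e) (behead_args a).
  by move=> i; rewrite !ffunE.
have e2 : has_degrees (belast_args e) (belast_args a).
  by move=> i; rewrite !ffunE.
have E al : extend (d_formula M al (cochain_part al f)) a =
   if alpha == al then d_formula M alpha f e a else 0.
  rewrite (extendE ea (vF al)) /d_formula.
  rewrite (cochain_partE _ f0 hf e1) (cochain_partE _ f0 hf e2).
  under eq_bigr => i _ do
    rewrite (cochain_partE _ f0 hf (has_degrees_face i ea)).
  case: eqP => [<-|_] //; rewrite linear0l linear0r scaler0 addr0 add0r.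
  by rewrite big1 ?scaler0 ?oppr0 // => i _; rewrite scaler0.
rewrite /d (bigD1 alpha) //= E eqxx big1 ?addr0 // => i ni.
by rewrite E eq_sym (negPf ni).
Qed.

Definition cochain1 (h : A -> B) : cochain 1 := fun a => h (a ord0).

Definition dH (M : bimodule A B) (H : A -> B) p (f : cochain p) :
  cochain p.+1 := fun a => d M f a + bracket (cochain1 H) f a.

Definition cocycle (M : bimodule A B) (H : A -> B) k (f : cochain k) : Prop :=
  multilinear f /\ forall a, dH M H f a = 0.

End Cohomology.

Section Truncated.
Variables (K : fieldType) (n : nat).

(* V[[t]]/(t^{n+1}), an element being given by its coefficients *)
Definition tseries (V : lmodType K) := {ffun 'I_n.+1 -> V}.

Definition tconst (V : lmodType K) (v : V) : tseries V :=
  [ffun k : 'I_n.+1 => if k == ord0 then v else 0].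

(* t-bilinear extension of a bilinear map *)
Definition tbilin (U V W : lmodType K) (b : U -> V -> W)
    (u : tseries U) (v : tseries V) : tseries W :=
  [ffun k : 'I_n.+1 => \sum_(i < n.+1) \sum_(j < n.+1 | (i + j)%N == k)
     b (u i) (v j)].

(* The t-linear map \sum_i t^i F_i *)
Definition tmap (V W : lmodType K) (F : 'I_n.+1 -> V -> W) (v : tseries V) :
  tseries W :=
  [ffun k : 'I_n.+1 => \sum_(i < n.+1) \sum_(j < n.+1 | (i + j)%N == k)
     F i (v j)].

End Truncated.

Section Deformation.
Variables (K : fieldType) (A B : superAlgType K) (M : bimodule A B).

Definition deformation (n : nat) (H : {linear A -> B})
    (Hs : 'I_n.+1 -> {linear A -> B}) : Prop :=
  let Ht := tmap (fun i => Hs i : A -> B) in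
  [/\ Hs ord0 =1 H,
      forall i : 'I_n.+1, (0 < i)%N -> even_map (Hs i)
    & forall x y : A, homogeneous x -> homogeneous y ->
        Ht (tconst n (smul x y)) =
          tbilin (ract M) (Ht (tconst n x)) (tconst n y)
          + tbilin (lact M) (tconst n x) (Ht (tconst n y))
          + tbilin (@smul K B) (Ht (tconst n x)) (Ht (tconst n y))].

Definition ob (n : nat) (Hs : 'I_n.+1 -> {linear A -> B}) (m : nat) :
  cochain A B 2 := fun a =>
  - (2%:R^-1 *: \sum_(i < n.+1 | (0 < i)%N)
                \sum_(j < n.+1 | (0 < j)%N && ((i + j)%N == m))
       bracket (cochain1 (Hs i)) (cochain1 (Hs j)) a).

End Deformation.

(* Main.v *)
Require Import Defs.
From mathcomp Require Import all_boot all_order all_algebra.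

Set Implicit Arguments.
Unset Strict Implicit.
Unset Printing Implicit Defensive.

Import GRing.Theory.
Local Open Scope ring_scope.

(** The obstruction is a coboundary. The coefficient of t^m in the equation that
    defines a deformation contains the products H_i(x)H_j(y) with i + j = m. The
    two terms with i = 0 or j = 0 involve H_0 = H and join the bimodule terms
    x.H_m(y) and H_m(x).y; what is left over is the sum over i, j >= 1, which is
    minus the obstruction because the even maps H_i make the bracket symmetric
    ([ob_sum]). So for homogeneous x and y ([ob_coboundary])
      ob_m(x, y) = x * H_m(y) + H_m(x) * y - H_m(xy),
    where x * v = x.v + H(x)v and v * x = v.x + vH(x).

    The equation satisfied by the crossed homomorphism H makes * again an
    A-bimodule structure on B ([tlact_mul], [tract_mul], [tract_tlact]), and on
    even cochains d_H is, up to a global sign, the Hochschild differential of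
    that bimodule. The statement thus reduces to the vanishing of the square of
    the Hochschild differential on one 1-cochain, where all terms cancel in pairs
    ([hochschild_coboundary_closed]).

    All maps involved are even, so every Koszul sign is +1. To pass
    from homogeneous to arbitrary arguments, [d_extend] and [bracket_extend]
    write d and the bracket of homogeneous cochains as the sum of a single
    formula over the homogeneous components of the arguments; d_H(ob_m) then
    vanishes component by component. *)

(** * Homogeneous components *)

Section Grading.
Variables (K : fieldType) (V : superspaceType K).

Lemma grade0 i : (0 : V) \in grade i.
Proof. by have [] := @grade_submod_closed K V i. Qed.

Lemma gradeN i (v : V) : v \in grade i -> - v \in grade i.
Proof. by rewrite -scaleN1r; apply: gradeZ. Qed.

Lemma grade_sum I (r : seq I) (P : pred I) (F : I -> V) i :
  (forall j, P j -> F j \in grade i) -> \sum_(j <- r | P j) F j \in grade i.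
Proof.
move=> Fi; elim/big_ind: _ => // [|x y xi yi]; first exact: grade0.
exact: gradeD.
Qed.

(** The decomposition into components is unique, so the components of a linear
    combination must be the combinations of the components. *)
Lemma part_linear i c (x y : V) : part i (c *: x + y) = c *: part i x + part i y.
Proof.
have G j : c *: part j x + part j y \in grade j.
  by rewrite gradeD ?gradeZ ?part_grade.
rewrite (partE (G false) (G true)); first by case: i.
by rewrite addrACA -scalerDr -!part_sum.
Qed.

End Grading.

(** * Extending the defining formulas to arbitrary arguments *)

Section Extension.
Variables (K : fieldType) (A B : superAlgType K).

Lemma components_degrees k (e : {ffun 'I_k -> bool}) (a : {ffun 'I_k -> A}) :
  has_degrees e (components e a).
Proof. by move=> i; rewrite ffunE part_grade. Qed.

Lemma components_subst k (e : {ffun 'I_k -> bool}) (a : {ffun 'I_k -> A}) i x :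
  components e (subst a i x) = subst (components e a) i (part (e i) x).
Proof. by apply/ffunP=> j; rewrite !ffunE; case: eqP => // ->. Qed.

Lemma multilinear_extend k (F : {ffun 'I_k -> bool} -> cochain A B k) :
  (forall e, multilinear (F e)) -> multilinear (extend F).
Proof.
move=> FL a i c x y; rewrite /extend scaler_sumr -big_split /=.
by apply: eq_bigr => e _; rewrite !components_subst part_linear FL.
Qed.

(** The bracket sums a formula over all pairs of homogeneous components of its
    two cochains. When these are homogeneous all but one of the components
    vanish, and a single formula remains even at inhomogeneous arguments. *)
Lemma bracket_extend p q alpha beta (f : cochain A B p) (g : cochain A B q) a :
  multilinear f -> multilinear g ->
  homog_cochain alpha f -> homog_cochain beta g ->
  bracket f g a = extend (bracket_formula alpha beta f g) a.
Proof.
move=> /multilinear_vanishing f0 /multilinear_vanishing g0 hf hg.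
rewrite /bracket /extend.
under eq_bigr do rewrite exchange_big /=.
rewrite exchange_big /=; apply: eq_bigr => e _.
move: (components e a) (@components_degrees _ e a) => {}a ea.
have e1 : has_degrees (firstp e) (firstp a) by move=> i; rewrite !ffunE.
have e2 : has_degrees (lastq e) (lastq a) by move=> i; rewrite !ffunE.
have e3 : has_degrees (firstq e) (firstq a) by move=> i; rewrite !ffunE.
have e4 : has_degrees (lastp e) (lastp a) by move=> i; rewrite !ffunE.
have E al be :
    bracket_formula al be (cochain_part al f) (cochain_part be g) e a
    = if (alpha == al) && (beta == be) then bracket_formula alpha beta f g e a
      else 0.
  rewrite /bracket_formula.
  rewrite (cochain_partE _ f0 hf e1) (cochain_partE _ f0 hf e4).
  rewrite (cochain_partE _ g0 hg e2) (cochain_partE _ g0 hg e3).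
  case: (alpha =P al) => [<-|_]; last by rewrite linear0l linear0r !scaler0 addr0.
  by case: (beta =P be) => [<-|_] //; rewrite linear0l linear0r !scaler0 addr0.
rewrite !big_bool /= !E; clear.
by case: alpha; case: beta; rewrite /= ?addr0 ?add0r.
Qed.

(** The analogue of [bracket_extend] for d: only the component of degree [alpha]
    contributes. *)
Lemma d_extend (M : bimodule A B) p alpha (f : cochain A B p) a :
  multilinear f -> homog_cochain alpha f ->
  d M f a = extend (d_formula M alpha f) a.
Proof.
move=> /multilinear_vanishing f0 hf.
rewrite /d /extend exchange_big /=; apply: eq_bigr => e _.
move: (components e a) (@components_degrees _ e a) => {}a ea.
have e1 : has_degrees (behead_args e) (behead_args a) by move=> i; rewrite !ffunE.
have e2 : has_degrees (belast_args e) (belast_args a) by move=> i; rewrite !ffunE.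
have E al : d_formula M al (cochain_part al f) e a =
    if alpha == al then d_formula M alpha f e a else 0.
  rewrite /d_formula (cochain_partE _ f0 hf e1) (cochain_partE _ f0 hf e2).
  under eq_bigr => i _ do rewrite (cochain_partE _ f0 hf (has_degrees_face i ea)).
  case: eqP => [<-|_] //; rewrite linear0l linear0r scaler0 addr0 add0r.
  by rewrite big1 ?scaler0 ?oppr0 // => i _; rewrite scaler0.
rewrite big_bool /= !E; clear.
by case: alpha; rewrite /= ?addr0 ?add0r.
Qed.

End Extension.

(** * The formulas on even cochains of low degree *)

Section LowDegree.
Variables (K : fieldType) (A B : superAlgType K).

Lemma multilinear_cochain1 (h : {linear A -> B}) : multilinear (cochain1 h).
Proof.
by move=> a i c x y; rewrite /cochain1 !ffunE (ord1 i) eqxx linearP.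
Qed.

Lemma homog_cochain1 (h : A -> B) : even_map h -> homog_cochain false (cochain1 h).
Proof.
move=> hE e a ea; rewrite /total_degree big_ord1 addFb.
by apply: hE; apply: ea.
Qed.

Lemma multilinear_smul2 (g h : {linear A -> B}) :
  multilinear (fun a : {ffun 'I_2 -> A} => smul (g (a ord0)) (h (a ord_max))).
Proof.
move=> a i c x y; rewrite !ffunE.
by case: (unliftP ord0 i) => [j|] ->;
  rewrite ?(ord1 j) ?eqxx /= linearP ?linearPl ?linearPr.
Qed.

Lemma bracket_formula1 (g h : A -> B) (e : {ffun 'I_2 -> bool}) a :
  bracket_formula (p := 1) (q := 1) false false (cochain1 g) (cochain1 h) e a =
  smul (h (a ord0)) (g (a ord_max)) + smul (g (a ord0)) (h (a ord_max)).
Proof.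
rewrite /bracket_formula /cochain1 !ffunE !mul0n /= expr0 expr2 mulN1r opprK.
rewrite !scale1r.
by congr (smul (h (a _)) (g (a _)) + smul (g (a _)) (h (a _))); apply: val_inj.
Qed.

(** Written in this form for the sake of multilinearity: the right-hand side is
    an [extend], to which [multilinear_extend] applies. *)
Lemma bracket1_extend (g h : {linear A -> B}) a : even_map g -> even_map h ->
  bracket (cochain1 g) (cochain1 h) a =
  extend (fun _ (b : {ffun 'I_2 -> A}) =>
    smul (h (b ord0)) (g (b ord_max)) + smul (g (b ord0)) (h (b ord_max))) a.
Proof.
move=> gE hE.
rewrite (bracket_extend _ (multilinear_cochain1 g) (multilinear_cochain1 h)
  (homog_cochain1 gE) (homog_cochain1 hE)).
by apply: eq_bigr => e _; rewrite bracket_formula1.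
Qed.

Lemma bracket1E (g h : {linear A -> B}) (e : {ffun 'I_2 -> bool}) a :
  even_map g -> even_map h -> has_degrees e a ->
  bracket (cochain1 g) (cochain1 h) a =
  smul (h (a ord0)) (g (a ord_max)) + smul (g (a ord0)) (h (a ord_max)).
Proof.
move=> gE hE ea.
rewrite (bracketE (multilinear_cochain1 g) (multilinear_cochain1 h)
  (homog_cochain1 gE) (homog_cochain1 hE) ea).
exact: bracket_formula1.
Qed.

Lemma multilinearD k (f g : cochain A B k) :
  multilinear f -> multilinear g -> multilinear (fun a => f a + g a).
Proof. by move=> fL gL a i c x y; rewrite fL gL scalerDr addrACA. Qed.

Lemma multilinearN k (f : cochain A B k) :
  multilinear f -> multilinear (fun a => - f a).
Proof. by move=> fL a i c x y; rewrite fL opprD scalerN. Qed.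

Lemma multilinearZ k b (f : cochain A B k) :
  multilinear f -> multilinear (fun a => b *: f a).
Proof. by move=> fL a i c x y; rewrite fL scalerDr !scalerA (mulrC b). Qed.

Lemma multilinear_sum k I (r : seq I) (P : pred I) (f : I -> cochain A B k) :
  (forall i, multilinear (f i)) -> multilinear (fun a => \sum_(i <- r | P i) f i a).
Proof.
move=> fL a j c x y; rewrite scaler_sumr -big_split.
by apply: eq_bigr => i _; apply: fL.
Qed.

Lemma multilinear_bracket1 (g h : {linear A -> B}) :
  even_map g -> even_map h -> multilinear (bracket (cochain1 g) (cochain1 h)).
Proof.
move=> gE hE a i c x y; rewrite !bracket1_extend //.
apply: multilinear_extend => e.
by apply: multilinearD; apply: multilinear_smul2.
Qed.

Definition pair_args (x y : A) : {ffun 'I_2 -> A} :=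
  [ffun i => if i == ord0 then x else y].

Lemma pair_args_eta (a : {ffun 'I_2 -> A}) : a = pair_args (a ord0) (a ord_max).
Proof.
apply/ffunP => i; rewrite ffunE.
by case: (unliftP ord0 i) => [j|] -> //; congr (a _); rewrite (ord1 j); apply: val_inj.
Qed.

(** The arguments selected by shifts, lifts and casts of ordinals are equal to
    the three named ones only up to [val_inj]; this identifies them by value. *)
Lemma arg3P (a : {ffun 'I_3 -> A}) :
  [/\ forall i : 'I_3, i = 0%N :> nat -> a i = a ord0,
      forall i : 'I_3, i = 1%N :> nat -> a i = a (inord 1)
    & forall i : 'I_3, i = 2%N :> nat -> a i = a ord_max].
Proof.
by split=> i iE; congr (a _); apply: val_inj; rewrite /= ?inordK.
Qed.

Lemma d_formula2 (M : bimodule A B) (f : cochain A B 2)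
    (e : {ffun 'I_3 -> bool}) (a : {ffun 'I_3 -> A}) :
  let x := a ord0 in let y := a (inord 1) in let z := a ord_max in
  d_formula M false f e a =
  - lact M x (f (pair_args y z)) + ract M (f (pair_args x y)) z
  + (f (pair_args (smul x y) z) - f (pair_args x (smul y z))).
Proof.
move=> x y z; rewrite /d_formula mul0n addn0.
have -> : (-1) ^+ (2 + 1) = -1 :> K by rewrite -signr_odd.
rewrite !scaleN1r opprK big_ord_recr big_ord1 /= expr0 expr1 scale1r scaleN1r.
have [] := arg3P a; rewrite -/x -/y -/z => x0 y1 z2.
have -> : behead_args a = pair_args y z.
  by rewrite [LHS]pair_args_eta !ffunE y1 // z2.
have -> : belast_args a = pair_args x y.
  by rewrite [LHS]pair_args_eta !ffunE (x0 _ _) // y1.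
have -> : face (widen_ord (leqnSn 1) ord0) a = pair_args (smul x y) z.
  by rewrite [LHS]pair_args_eta !ffunE /= (x0 _ _) // y1 // z2.
have -> : face ord_max a = pair_args x (smul y z).
  by rewrite [LHS]pair_args_eta !ffunE /= (x0 _ _) // y1 // z2.
by [].
Qed.

Lemma bracket_formula12 (g : A -> B) (f : cochain A B 2)
    (e : {ffun 'I_3 -> bool}) (a : {ffun 'I_3 -> A}) :
  let x := a ord0 in let y := a (inord 1) in let z := a ord_max in
  bracket_formula (p := 1) (q := 2) false false (cochain1 g) f e a =
  smul (f (pair_args x y)) (g z) - smul (g x) (f (pair_args y z)).
Proof.
move=> x y z; rewrite /bracket_formula !mul0n !addn0 expr0 scale1r.
have -> : (-1) ^+ (1 * 2 + 1) = -1 :> K by rewrite -signr_odd.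
have [] := arg3P a; rewrite -/x -/y -/z => x0 y1 z2.
have -> : firstq (p := 1) (q := 2) a = pair_args x y.
  by rewrite [LHS]pair_args_eta !ffunE (x0 _ _) // y1.
have -> : lastq (p := 1) (q := 2) a = pair_args y z.
  by rewrite [LHS]pair_args_eta !ffunE y1 // z2.
by rewrite scaleN1r /cochain1 !ffunE (z2 _ _) // (x0 _ _).
Qed.

End LowDegree.

(** * The bimodule twisted by a crossed homomorphism *)

Section Twisted.
Variables (K : fieldType) (A B : superAlgType K) (M : bimodule A B).
Variable H : {linear A -> B}.
Hypothesis crossedH : crossed_hom M H.

Definition tlact (a : A) (v : B) : B := lact M a v + smul (H a) v.
Definition tract (v : B) (a : A) : B := ract M v a + smul v (H a).

Lemma tlactD a u v : tlact a (u + v) = tlact a u + tlact a v.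
Proof. by rewrite /tlact !linearD addrACA. Qed.

Lemma tlactB a u v : tlact a (u - v) = tlact a u - tlact a v.
Proof. by rewrite /tlact !linearB /= opprD addrACA. Qed.

Lemma tractD a u v : tract (u + v) a = tract u a + tract v a.
Proof. by rewrite /tract !linearDl addrACA. Qed.

Lemma tractB a u v : tract (u - v) a = tract u a - tract v a.
Proof. by rewrite /tract !linearBl /= opprD addrACA. Qed.

Lemma crossed_homogeneous a : homogeneous a -> homogeneous (H a).
Proof. by case: crossedH => HE _ [i ai]; exists i; apply: HE. Qed.

(** The equation of crossed homomorphisms expands H(ab)v into three terms, which
    complete (ab).v = a.(b.v) to the twisted action of a on that of b on v. *)
Lemma tlact_mul a b v : homogeneous a -> homogeneous b -> homogeneous v ->
  tlact (smul a b) v = tlact a (tlact b v).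
Proof.
move=> ah bh vh; have [_ Hm] := crossedH.
have Ha := crossed_homogeneous ah; have Hb := crossed_homogeneous bh.
rewrite tlactD /tlact Hm // !linearDl /= bimod_mulll // bimod_lmul //.
by rewrite bimod_mid // smulA !addrA; congr (_ + _); rewrite addrAC.
Qed.

Lemma tract_mul a b v : homogeneous a -> homogeneous b -> homogeneous v ->
  tract (tract v a) b = tract v (smul a b).
Proof.
move=> ah bh vh; have [_ Hm] := crossedH.
have Ha := crossed_homogeneous ah; have Hb := crossed_homogeneous bh.
rewrite tractD /tract Hm // !linearDr /= bimod_mulrr // bimod_mid //.
by rewrite bimod_rmul // smulA !addrA; congr (_ + _); rewrite addrAC.
Qed.

Lemma tract_tlact a b v : homogeneous a -> homogeneous b -> homogeneous v ->
  tract (tlact a v) b = tlact a (tract v b).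
Proof.
move=> ah bh vh.
have Ha := crossed_homogeneous ah; have Hb := crossed_homogeneous bh.
rewrite tlactD tractD /tlact /tract.
by rewrite bimod_lr // bimod_lmul // bimod_rmul // smulA addrACA.
Qed.

(** The coboundary of the 1-cochain [h] with coefficients in the twisted
    bimodule; it is also d_H(h) for even [h]. *)
Definition hochschild1 (h : A -> B) (x y : A) : B :=
  tlact x (h y) + tract (h x) y - h (smul x y).

(** The square of the Hochschild differential vanishes: once the bimodule axioms
    and associativity are applied, six terms each occur twice with opposite
    signs. *)
Lemma hochschild_coboundary_closed (h : A -> B) x y z : even_map h ->
  homogeneous x -> homogeneous y -> homogeneous z ->
  let f := hochschild1 h in
  - tlact x (f y z) + tract (f x y) z
  + (f (smul x y) z - f x (smul y z)) = 0.
Proof.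
move=> hE xh yh zh f.
have hh v : homogeneous v -> homogeneous (h v) by case=> i vi; exists i; apply: hE.
rewrite /f /hochschild1 tlactB tlactD tractB tractD smulA.
rewrite tlact_mul ?tract_tlact ?tract_mul //; try exact: hh.
set p1 := tlact x (tlact y _); set p2 := tlact x (tract _ _).
set p3 := tlact x (h _); set p4 := tract (h x) _; set p5 := tract (h _) z.
set p6 := h _.
have -> : p1 + p5 - p6 - (p3 + p4 - p6) = (p1 - p3) - (p4 - p5).
  by rewrite opprB addrA subrK opprD addrACA opprB.
have -> : - (p1 + p2 - p3) + (p2 + p4 - p5) = (p4 - p5) - (p1 - p3).
  by rewrite (addrAC p1) opprD -(addrA (- (p1 - p3))) -(addrA p2) addKr addrC.
by rewrite addrC addrA subrK subrr.
Qed.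

End Twisted.

(** * Sums over pairs of indices with a given sum *)

Section Sums.
Variables (n : nat) (V : zmodType).
Implicit Types (G : 'I_n.+1 -> 'I_n.+1 -> V) (k : 'I_n.+1).

Lemma antidiag_split G k : (0 < k)%N ->
  \sum_(i < n.+1) \sum_(j < n.+1 | (i + j)%N == k) G i j =
  G ord0 k + G k ord0
  + \sum_(i < n.+1 | (0 < i)%N)
      \sum_(j < n.+1 | (0 < j)%N && ((i + j)%N == k)) G i j.
Proof.
move=> k0.
have pos (i : 'I_n.+1) : (i != ord0) = (0 < i)%N by rewrite lt0n.
rewrite (bigD1 ord0) //= (big_pred1 k) => [|j]; last by rewrite add0n.
rewrite -addrA; congr (_ + _); rewrite (eq_bigl _ _ pos).
have -> : G k ord0 = \sum_(i < n.+1 | (0 < i)%N) if i == k then G i ord0 else 0.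
  by rewrite -big_mkcondr (big_pred1 k) // => i /=; case: eqP => [->|]; rewrite ?k0 ?andbF.
rewrite -big_split /=; apply: eq_bigr => i _.
rewrite big_mkcond (bigD1 ord0) //= addn0; congr (_ + _).
by rewrite -big_mkcondr; apply: eq_bigl => j; rewrite pos.
Qed.

Lemma antidiag0l G k : (forall i j : 'I_n.+1, (0 < i)%N -> G i j = 0) ->
  \sum_(i < n.+1) \sum_(j < n.+1 | (i + j)%N == k) G i j = G ord0 k.
Proof.
move=> G0; rewrite (bigD1 ord0) //= (big_pred1 k) => [|j]; last by rewrite add0n.
rewrite big1 ?addr0 // => i i0; rewrite big1 // => j _; apply: G0.
by rewrite lt0n.
Qed.

Lemma antidiag0r G k : (forall i j : 'I_n.+1, (0 < j)%N -> G i j = 0) ->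
  \sum_(i < n.+1) \sum_(j < n.+1 | (i + j)%N == k) G i j = G k ord0.
Proof.
move=> G0; rewrite (exchange_big_dep xpredT) //=.
under eq_bigr do under eq_bigl do rewrite addnC.
by apply: (antidiag0l (G := fun j i => G i j)) => j i; apply: G0.
Qed.

Lemma antidiag_pos_sym G m :
  \sum_(i < n.+1 | (0 < i)%N)
     \sum_(j < n.+1 | (0 < j)%N && ((i + j)%N == m)) G j i =
  \sum_(i < n.+1 | (0 < i)%N)
     \sum_(j < n.+1 | (0 < j)%N && ((i + j)%N == m)) G i j.
Proof.
rewrite (exchange_big_dep (fun j : 'I_n.+1 => (0 < j)%N)) => [|i j _ /andP[] //].
by apply: eq_bigr => j j0; apply: eq_bigl => i; rewrite j0 addnC.
Qed.

End Sums.

(** * The obstruction as a coboundary *)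

Section Obstruction.
Variables (K : fieldType) (A B : superAlgType K) (M : bimodule A B).
Variables (H : {linear A -> B}) (n : nat) (Hs : 'I_n.+1 -> {linear A -> B}).
Hypothesis crossedH : crossed_hom M H.
Hypothesis defH : deformation M H Hs.

Lemma deformation_even i : even_map (Hs i).
Proof.
case: defH => Hs0 HsE _; case: (posnP i) => [i0|]; last exact: HsE.
have -> : i = ord0 by apply: val_inj.
by move=> b v vb; rewrite Hs0; case: crossedH => HE _; apply: HE.
Qed.

(** The coefficient of t^k in the deformation equation. *)
Lemma deformation_coef (k : 'I_n.+1) x y : homogeneous x -> homogeneous y ->
  Hs k (smul x y) = ract M (Hs k x) y + lact M x (Hs k y)
    + \sum_(i < n.+1) \sum_(j < n.+1 | (i + j)%N == k) smul (Hs i x) (Hs j y).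
Proof.
case: defH => _ _ defm xh yh.
have tmapE v i : tmap (fun i => Hs i : A -> B) (tconst n v) i = Hs i v.
  rewrite ffunE antidiag0r ?ffunE //= => i' j j0.
  by rewrite ffunE -val_eqE /= gtn_eqF // linear0.
move/ffunP/(_ k): (defm x y xh yh); rewrite tmapE => ->.
rewrite !ffunE; congr (_ + _ + _).
- rewrite antidiag0r => [|i j j0]; first by rewrite tmapE ffunE.
  by rewrite [tconst _ _ j]ffunE -val_eqE /= gtn_eqF // linear0r.
- rewrite antidiag0l => [|i j i0]; first by rewrite tmapE ffunE.
  by rewrite [tconst _ _ i]ffunE -val_eqE /= gtn_eqF // linear0l.
by apply: eq_bigr => i _; apply: eq_bigr => j _; rewrite !tmapE.
Qed.

Lemma multilinear_ob m : multilinear (ob Hs m).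
Proof.
apply: multilinearN; apply: multilinearZ.
apply: multilinear_sum => i; apply: multilinear_sum => j.
by apply: multilinear_bracket1; apply: deformation_even.
Qed.

Hypothesis charK : [pchar K] =i pred0.

(** The bracket of H_i and H_j consists of the products taken in both orders, so
    the symmetric sum counts every product twice; the factor 1/2 removes this. *)
Lemma ob_sum m (e : {ffun 'I_2 -> bool}) a : has_degrees e a ->
  ob Hs m a = - \sum_(i < n.+1 | (0 < i)%N)
     \sum_(j < n.+1 | (0 < j)%N && ((i + j)%N == m))
       smul (Hs i (a ord0)) (Hs j (a ord_max)).
Proof.
move=> ea; rewrite /ob; congr (- _).
under eq_bigr => i _.
  under eq_bigr => j _ do
    rewrite (bracket1E (@deformation_even i) (@deformation_even j) ea).
  rewrite big_split /=; over.
rewrite big_split /= antidiag_pos_sym -mulr2n -scaler_nat scalerA mulVf ?scale1r //.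
by rewrite ((pcharf0P K).1 charK).
Qed.

Lemma homog_ob m : homog_cochain false (ob Hs m).
Proof.
move=> e a ea; rewrite (ob_sum m ea) addFb.
apply: gradeN; apply: grade_sum => i _; apply: grade_sum => j _.
rewrite /total_degree big_ord_recr big_ord1 /=.
apply: smul_grade; apply: deformation_even.
  by have := ea ord0; congr (_ \in grade (e _)); apply: val_inj.
exact: ea.
Qed.

(** Comparing with the coefficient of t^k: the terms (0, k) and (k, 0) of the
    convolution turn the two actions into the twisted ones. *)
Lemma ob_coboundary (k : 'I_n.+1) x y : (0 < k)%N ->
  homogeneous x -> homogeneous y ->
  ob Hs k (pair_args x y) = hochschild1 M H (Hs k) x y.
Proof.
move=> k0 xh yh; have [i xi] := xh; have [j yj] := yh.
have e2 : has_degrees [ffun l : 'I_2 => if l == ord0 then i else j] (pair_args x y).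
  by move=> l; rewrite !ffunE; case: eqP.
case: defH => Hs0 _ _.
rewrite (ob_sum _ e2) /hochschild1 deformation_coef // antidiag_split //.
rewrite !Hs0 !ffunE /= /tlact /tract.
set P := \sum_(_ < _ | _) _.
set p := lact M _ _; set q := smul (H x) _; set r := ract M _ _.
set s := smul _ _.
by rewrite (addrACA p q r s) (addrC p r) (addrA (r + p) (q + s)) opprD addNKr.
Qed.

Lemma cocycle_ob m : (0 < m <= n)%N -> cocycle M H (ob Hs m).
Proof.
move=> /andP[m0 mn]; split=> [|a]; first exact: multilinear_ob.
have HE : even_map H by case: crossedH.
rewrite /dH (d_extend _ _ (multilinear_ob m) (homog_ob m)).
rewrite (bracket_extend _ (multilinear_cochain1 H) (multilinear_ob m)
  (homog_cochain1 HE) (homog_ob m)).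
rewrite -big_split big1 //= => e _.
move: (components e a) (@components_degrees _ _ _ e a) => {}a ea.
have ah i : homogeneous (a i) by exists (e i).
rewrite d_formula2 bracket_formula12.
set x := a ord0; set y := a (inord 1); set z := a ord_max.
have xyh : homogeneous (smul x y) by eexists; apply: smul_grade; apply: ea.
have yzh : homogeneous (smul y z) by eexists; apply: smul_grade; apply: ea.
have [xh yh zh] : [/\ homogeneous x, homogeneous y & homogeneous z].
  by split; apply: ah.
pose k : 'I_n.+1 := Ordinal (mn : (m < n.+1)%N).
have obE := @ob_coboundary k _ _ m0.
have := hochschild_coboundary_closed crossedH (deformation_even k) xh yh zh.
rewrite /= -!obE // => <-.
(* The terms of the bracket with H are the corrections that turn the actions
   occurring in d into the twisted ones. *)
rewrite /tlact /tract opprD; set u := ob _ _ _; set v := ob _ _ _.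
set w := ob _ _ _ - _.
by rewrite [LHS]addrAC (addrC (smul v _)); congr (_ + w); rewrite addrACA.
Qed.

End Obstruction.

Theorem theorem4p1 (K : fieldType) (charK : [pchar K] =i pred0)
  (A B : superAlgType K) (M : bimodule A B)
  (H : {linear A -> B}) (crossedH : crossed_hom M H)
  (n : nat) (Hs : 'I_n.+1 -> {linear A -> B}) (defH : deformation M H Hs)
  (m : nat) (m_ge1 : (1 <= m)%N) (m_len : (m <= n)%N) :
  cocycle M H (ob Hs m).
Proof. by apply: cocycle_ob => //; apply/andP. Qed.
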